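(* Let $x_0\in Q$, $\epsilon>0$, and $R_0>0$ with $\|x_0-x^*\|\le R_0$. Put $\tau=\frac{2(\rho-1)}{\rho}$ and $m=\left\lfloor \log_2\left(\frac{\mu(f)}{\epsilon}R_0^\rho\right)\right\rfloor+1$, where $\lfloor a\rfloor$ denotes the largest integer strictly smaller than $a$. Define the multistage procedure: $y_0=x_0$, and for $k=1,\dots,m$, $$N_k=\left\lfloor 2^{\tau k}\frac{4L^2A(d)}{\mu^2(f)\mu(d)R_0^{2(\rho-1)}}\right\rfloor,\qquad R_k^\rho=2^{-k}R_0^\rho,\qquad y_k=x_{N_k}(y_{k-1},R_{k-1}),$$ where $x_{N_k}(y_{k-1},R_{k-1})$ is the output of the dual averaging method with parameter $\gamma=\gamma_k=\frac{LR_{k-1}}{\sqrt{2\mu(d)A(d)}}$; the final output is $\hat x_\epsilon(y_0,R_0)=y_m$. Then the points $\{y_k\}_{k=1}^m$ satisfy $$\|y_k-x^*\|^\rho\le R_k^\rho=2^{-k}R_0^\rho,\quad k=0,\dots,m,$$ $$\delta_{N_k}(y_{k-1},R_{k-1})\le \mu(f)R_k^\rho=\mu(f)2^{-k}R_0^\rho,\quad k=1,\dots,m.$$ Moreover, $f(\hat x_\epsilon(y_0,R_0))-f^*\le\epsilon$, and the total number $N(\epsilon)$ of iterations in the scheme does not exceed $$\left(\frac{2^{m+1}}{R_0^\rho}\right)^\tau\frac{4L^2A(d)}{\mu^2(f)\mu(d)}\le\frac{4^{\tau+1}L^2A(d)}{\mu(f)^{2/\rho}\mu(d)}\,\epsi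lon^{-\tau}.$$
   Context: $E$ is a finite-dimensional real vector space with norm $\|\cdot\|$; $E^*$ is its dual, $\langle s,x\rangle$ the pairing, $\|s\|_*=\max_{\|x\|\le1}\langle s,x\rangle$; $B$ is the unit ball of $\|\cdot\|$ and $B_R(z)=\{y:\|y-z\|\le R\}$. Problem: $Q\subset E$ is a closed convex set, $f:Q\to\mathbb R$ is uniformly convex with parameters $\rho\ge2$ and $\mu(f)>0$, i.e. for all $x,y\in Q$, $\alpha\in[0,1]$, $$f(\alpha x+(1-\alpha)y)\le\alpha f(x)+(1-\alpha)f(y)-\tfrac12\mu(f)\alpha(1-\alpha)[\alpha^{\rho-1}+(1-\alpha)^{\rho-1}]\|x-y\|^\rho .$$ For each $x\in Q$ a subgradient $f'(x)\in E^*$ (meaning $f(y)\ge f(x)+\langle f'(x),y-x\rangle$ for all $y\in Q$) is supplied by the oracle, with $\|f'(x)\|_*\le L$. $f^*=\min_Q f$, attained at $x^*$. Prox-function: $d:B\to\mathbb R$ is continuous, $d(x)\ge d(0)=0$ on $B$, and strongly convex with parameter $\mu(d)>0$: $d(\alpha x+(1-\alpha)y)\le\alpha d(x)+(1-\alpha)d(y)-\frac12\mu(d)\alpha(1-\alpha)\|x-y\|^2$. $A(d)=\max_B d$. For $z\in Q$, $R>0$, $\beta>0$: $Q_R(z)=Q\cap B_R(z)$, $d_{z,R}(x)=d\left(\frac1R(x-z)\right)$, $\pi_{z,R,\beta}(s)=\arg\max\{\langle s,x-z\rangle-\beta d_{z,R}(x):x\in Q_R(z)\}$. Dual averaging method with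 parameter $\gamma>0$, center $\bar x\in Q$, radius $R>0$, and $N\ge0$ iterations: put $\beta=\gamma\sqrt{N+1}$, $x_0=\bar x$, $s_0=0$, and for $k=0,1,\dots,N-1$: $s_{k+1}=s_k+f'(x_k)$, $x_{k+1}=\pi_{\bar x,R,\beta}(-s_{k+1})$. Output: $x_N(\bar x,R)=\frac1{N+1}\sum_{i=0}^Nx_i$. Gap value: $\delta_N(\bar x,R)=\max\left\{\frac1{N+1}\sum_{i=0}^N\langle f'(x_i),x_i-x\rangle:x\in Q_R(\bar x)\right\}$.
   Formalization: The bound f(x̂)−f* ≤ ε is stated for m ≥ 1 only: at m = 0 the output is x_0 and it fails (Q=[-1,1], f=c|x|+x², c>1, ρ=2, x_0=R_0=1, ε=μ(f)=2); for m < 0 y_m is undefined. N_k = −1 (L = 0 or A(d) = 0) is read as 0 iterations. *)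

(* Defs.v *)
From HB Require Import structures.
From mathcomp Require Import all_boot all_order all_algebra.
From mathcomp Require Import all_classical all_reals all_analysis.

Set Implicit Arguments.
Unset Strict Implicit.
Unset Printing Implicit Defensive.

Import Order.TTheory GRing.Theory Num.Theory.
Import numFieldNormedType.Exports.

Local Open Scope classical_set_scope.
Local Open Scope ring_scope.

(* Some maximizer of [g] on [S]; the value is [0] when there is none. *)
Definition argmax (R : realType) (E : normedModType R) (S : set E)
    (g : E -> R) : E :=
  xget 0 [set y | S y /\ forall x, S x -> g x <= g y].

(* The largest integer strictly smaller than [a] (so one less than the usual
   floor when [a] is an integer). *)
Definition strict_floor (R : realType) (a : R) : int := Num.ceil a - 1.

Lemma strict_floorP (R : realType) (a : R) (n : int) :
  (n <= strict_floor a) = (n%:~R < a).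
Proof. by rewrite /strict_floor lerBrDr lezD1 ceil_gt_int. Qed.

Section Problem.
Variables (R : realType) (E : normedModType R).
Implicit Types (Q : set E) (f d s : E -> R) (x y z : E).

Definition unit_ball : set E := [set x | `|x| <= 1].

(* In finite dimension the suprema in [dual_norm], [prox_max] and [da_gap] are
   attained, so they are maxima. *)
Definition dual_norm (s : {scalar E}) : R := sup [set s x | x in unit_ball].

Definition uniformly_convex Q f (rho mu : R) : Prop :=
  forall x y (a : R), Q x -> Q y -> 0 <= a <= 1 ->
    f (a *: x + (1 - a) *: y) <=
      a * f x + (1 - a) * f y
      - 2^-1 * mu * a * (1 - a) *
        (a `^ (rho - 1) + (1 - a) `^ (rho - 1)) * `|x - y| `^ rho.

Definition strongly_convex Q f (mu : R) : Prop :=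
  forall x y (a : R), Q x -> Q y -> 0 <= a <= 1 ->
    f (a *: x + (1 - a) *: y) <=
      a * f x + (1 - a) * f y - 2^-1 * mu * a * (1 - a) * `|x - y| ^+ 2.

Definition is_subgradient Q f x (g : {scalar E}) : Prop :=
  forall y, Q y -> f x + g (y - x) <= f y.

(* The constant A(d) of the prox-function. *)
Definition prox_max d : R := sup [set d x | x in unit_ball].

Definition local_set Q z (r : R) : set E := Q `&` [set x | `|x - z| <= r].

Definition scaled_prox d z (r : R) x : R := d (r^-1 *: (x - z)).

Definition prox_map Q d z (r beta : R) s : E :=
  argmax (local_set Q z r) (fun x => s (x - z) - beta * scaled_prox d z r x).

(* The pair (x_k, s_k); the dual element s_k is kept as a plain function. *)
Fixpoint dual_averaging Q d (f' : E -> {scalar E}) z (r beta : R) (k : nat) :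
    E * (E -> R) :=
  if k is j.+1 then
    let: (x, s) := dual_averaging Q d f' z r beta j in
    let s' := s \+ f' x in (prox_map Q d z r beta (\- s'), s')
  else (z, cst 0).

Definition da_iterate Q d (f' : E -> {scalar E}) (gamma : R) (N : nat) z (r : R)
    (i : nat) : E :=
  (dual_averaging Q d f' z r (gamma * Num.sqrt N.+1%:R) i).1.

Definition da_output Q d (f' : E -> {scalar E}) (gamma : R) (N : nat) z (r : R) :
    E :=
  N.+1%:R^-1 *: \sum_(i < N.+1) da_iterate Q d f' gamma N z r i.

Definition da_gap Q d (f' : E -> {scalar E}) (gamma : R) (N : nat) z (r : R) : R :=
  sup [set N.+1%:R^-1 * \sum_(i < N.+1)
             (let xi := da_iterate Q d f' gamma N z r i in f' xi (xi - x))
      | x in local_set Q z r].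

(* The strict floor can be nonpositive, in which case there is no stage. *)
Definition num_stages (muf eps R0 rho : R) : int :=
  strict_floor (ln (muf / eps * R0 `^ rho) / ln 2) + 1.

(* The strict floor is -1 when L = 0 or A(d) = 0; this is read as no
   iteration. *)
Definition stage_iterations (L muf mud A R0 rho : R) (k : nat) : nat :=
  `|(Num.max 0 (strict_floor
      (2 `^ (2 * (rho - 1) / rho * k%:R) *
       (4 * L ^+ 2 * A / (muf ^+ 2 * mud * R0 `^ (2 * (rho - 1)))))))%R|%N.

Definition stage_radius (R0 rho : R) (k : nat) : R :=
  (2 ^- k * R0 `^ rho) `^ rho^-1.

Definition stage_gamma (L mud A r : R) : R := L * r / Num.sqrt (2 * mud * A).

Fixpoint stage_point Q d (f' : E -> {scalar E}) (rho muf mud L R0 : R) x0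
    (k : nat) : E :=
  if k is j.+1 then
    let r := stage_radius R0 rho j in
    da_output Q d f' (stage_gamma L mud (prox_max d) r)
      (stage_iterations L muf mud (prox_max d) R0 rho k)
      (stage_point Q d f' rho muf mud L R0 x0 j) r
  else x0.

(* The gap value at the end of stage k >= 1. *)
Definition stage_gap Q d (f' : E -> {scalar E}) (rho muf mud L R0 : R) x0
    (k : nat) : R :=
  let r := stage_radius R0 rho k.-1 in
  da_gap Q d f' (stage_gamma L mud (prox_max d) r)
    (stage_iterations L muf mud (prox_max d) R0 rho k)
    (stage_point Q d f' rho muf mud L R0 x0 k.-1) r.

End Problem.
Arguments unit_ball {R E}.

(* Main.v *)
From HB Require Import structures.
Require Import Defs.
From mathcomp Require Import all_boot all_order all_algebra.
From mathcomp Require Import all_classical all_reals all_analysis.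
From mathcomp Require Import ring lra.
Import Order.TTheory GRing.Theory Num.Theory.
Import numFieldNormedType.Exports.
Local Open Scope classical_set_scope.
Local Open Scope ring_scope.

(** Dual averaging: strong concavity of the prox-subproblem at its maximizer
    x_k gives, by induction on k, the estimate
      -s_k(x - z) - beta d(x) <= - sum_(i<k) f'(x_i)(x_i - z)
                                 + k L^2 r^2 / (2 beta mu(d))
    on the local set, so the choice of gamma bounds the gap by
    L r sqrt(2 A(d) / (mu(d) (N + 1))); with N = N_k this is at most
    mu(f) 2^(-k) R_0^rho because rho >= 2.  Conversely, uniform convexity used
    both at x_i (with f'(x_i)) and at the minimizer (with the zero subgradient)
    gives mu(f) |x_i - xs|^rho <= f'(x_i)(x_i - xs), the two halves adding up to
    the full constant; convexity of the rho-th power of the norm then bounds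
    mu(f) |y_k - xs|^rho by the gap, so xs lies in the ball of the next stage.

    The step parameter gamma vanishes when L = 0 or A(d) = 0; then all
    subgradients vanish on E, or E is trivial, and the gap bound still holds. *)

(** * Finite-dimensional normed spaces *)

Section FiniteDimension.
Context {R : realType}.

Lemma mx_entry_le_norm {n : nat} (w : 'rV[R]_n) (i : 'I_n) : `|w ord0 i| <= `|w|.
Proof.
rewrite [leRHS]/Num.norm /= mx_normrE; apply/bigmax_geP; right => /=.
by exists (ord0, i).
Qed.

Lemma linear_rV_bounded {n : nat} {E : normedModType R}
    (u : {linear 'rV[R]_n -> E}) :
  exists K, forall w, `|u w| <= K * `|w|.
Proof.
exists (\sum_i `|u (delta_mx 0 i)|) => w.
rewrite {1}[w]row_sum_delta linear_sum mulr_suml.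
apply: (le_trans (ler_norm_sum _ _ _)); apply: ler_sum => i _.
by rewrite linearZ normrZ mulrC ler_wpM2l// mx_entry_le_norm.
Qed.

Lemma norm_bounded_linear_continuous {V W : normedModType R}
    (u : {linear V -> W}) (K : R) :
  (forall x, `|u x| <= K * `|x|) -> continuous u.
Proof.
move=> uK; apply/linear_bounded_continuous/bounded_funP => r.
exists (`|K| * r) => x xr.
rewrite (le_trans (uK _))// (le_trans (ler_wpM2r _ (ler_norm K)))//.
by rewrite ler_wpM2l.
Qed.

Lemma linear_rV_continuous {n : nat} {E : normedModType R}
    (u : {linear 'rV[R]_n -> E}) : continuous u.
Proof.
by have [K uK] := linear_rV_bounded u; exact: norm_bounded_linear_continuous uK.
Qed.

Context {n : nat} {E : normedModType R}.
Hypothesis E_dim : Vector.axiom n E.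

(** Equivalence of norms: on the compact unit sphere of row vectors the continuous function [|u w|]
    attains its minimum, which is positive because [u] is injective. The inverse of this minimum is
    the constant [c]. *)
Lemma finite_dim_coordinates :
  exists (u : {linear 'rV[R]_n -> E}) (v : E -> 'rV[R]_n) (c : R),
    [/\ cancel v u, cancel u v & forall x, `|v x| <= c * `|x|].
Proof.
case: E_dim => v v_lin [g vg gv].
have g_lin : linear g.
  by move=> a x y; apply: (can_inj vg); rewrite v_lin !gv.
have [u uE] : exists u : {linear 'rV[R]_n -> E}, u =1 g.
  by exists (HB.pack_for {linear 'rV[R]_n -> E} g
    (GRing.isLinear.Build _ _ _ _ _ g_lin)).
have {}vg : cancel v u by move=> x; rewrite uE.
have {}gv : cancel u v by move=> x; rewrite uE.
have u0 w : u w = 0 -> w = 0.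
  by move=> uw; rewrite -[w]gv uw -(linear0 u) gv.
have normu_cont : continuous (fun w => `|u w|).
  move=> w; apply: continuous_comp; last exact: norm_continuous.
  exact: linear_rV_continuous.
suff [c c_gt0 uc] : exists2 c : R, 0 < c & forall w, c * `|w| <= `|u w|.
  exists u, v, c^-1; split=> // x.
  by rewrite mulrC ler_pdivlMr// mulrC (le_trans (uc _))// vg.
pose S := [set w : 'rV[R]_n | `|w| = 1].
have S_unit w : w != 0 -> S (`|w|^-1 *: w).
  by move=> w0; rewrite /S /= normrZ normfV normr_id mulVf// normr_eq0.
(* If the sphere is empty, every row vector is zero and any positive constant will do. *)
have [S0|/set0P/negP/negPn/eqP S0] := pselect (S !=set0); last first.
  exists 1 => // w; have [->|/S_unit] := eqVneq w 0; first by rewrite normr0 mulr0.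
  by rewrite S0.
have S_compact : compact S.
  apply: bounded_closed_compact.
    by exists 1; split => // M M1 w /= ->; exact: ltW.
  apply: (@closed_comp _ _ (fun w : 'rV[R]_n => `|w|) [set 1]).
    by move=> w _; exact: norm_continuous.
  exact: closed_eq.
have [w0 /set_mem /= w0S w0min] :=
  compact_EVT_min S0 S_compact (continuous_subspaceT normu_cont).
exists `|u w0|.
  rewrite normr_gt0; apply/eqP => /u0 w00; move: w0S; rewrite /S /= w00 normr0.
  by move/esym/eqP; rewrite oner_eq0.
move=> w; have [->|w_neq0] := eqVneq w 0; first by rewrite normr0 mulr0.
rewrite -ler_pdivlMr ?normr_gt0//.
have /mem_set /w0min := S_unit _ w_neq0.
by rewrite linearZ normrZ normfV normr_id mulrC.
Qed.

(** Heine-Borel is carried over from row vectors: [A] is the continuous image under [u] of its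
    preimage, which is closed, and bounded by the estimate on [v]. *)
Lemma finite_dim_compact (A : set E) (M : R) :
  (forall x, A x -> `|x| <= M) -> closed A -> compact A.
Proof.
move=> A_le A_closed; have [u [v [c [vu uv v_le]]]] := finite_dim_coordinates.
have -> : A = u @` (u @^-1` A).
  apply/seteqP; split=> [x Ax|_ [w Auw <-]//].
  by exists (v x) => //=; rewrite vu.
apply: continuous_compact.
  by apply: continuous_subspaceT; exact: linear_rV_continuous.
apply: bounded_closed_compact; last first.
  by apply: closed_comp => // w _; exact: linear_rV_continuous.
exists (`|c| * M); split => [//|K MK w /= Auw]; first exact: num_real.
rewrite (le_trans _ (ltW MK))// -[w]uv (le_trans (v_le _))//.
rewrite (le_trans (ler_wpM2r _ (ler_norm c)))// ler_wpM2l//.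
exact: A_le.
Qed.

Lemma finite_dim_scalar_bounded (s : {scalar E}) :
  exists C, forall x, `|s x| <= C * `|x|.
Proof.
have [u [v [c [vu uv v_le]]]] := finite_dim_coordinates.
have su_lin : linear (s \o u : _ -> R^o) by move=> a x y /=; rewrite !linearP.
have [su suE] : exists su : {linear 'rV[R]_n -> R^o}, su =1 s \o u.
  by exists (HB.pack_for {linear 'rV[R]_n -> R^o} (s \o u : _ -> R^o)
    (GRing.isLinear.Build _ _ _ _ _ su_lin)).
have [K su_le] := linear_rV_bounded su.
exists (`|K| * c) => x; rewrite -[in leLHS](vu x).
rewrite -[s _]suE (le_trans (su_le _))// (le_trans (ler_wpM2r _ (ler_norm K)))//.
by rewrite -mulrA ler_wpM2l.
Qed.

End FiniteDimension.

(** * Strong and uniform convexity *)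

(** Serves [scaled_prox]: [d] is continuous only relative to the unit ball, and the rescaling sends
    the local set into that ball. *)
Lemma within_continuous_comp_sub {T U V : topologicalType} (A : set T)
    (B : set U) (g : T -> U) (h : U -> V) :
  (forall x, A x -> B (g x)) -> continuous g ->
  {within B, continuous h} -> {within A, continuous (h \o g)}.
Proof.
move=> AB g_cont /subspace_continuousP h_cont; apply/subspace_continuousP => x Ax.
move=> W /(h_cont _ (AB _ Ax)) /= hW.
have := g_cont x _ hW; rewrite /within /= !nbhs_simpl /= => gW.
apply: (@filterS _ (nbhs x) _ _ _ _ gW) => t /= BW At.
exact: BW (AB _ At).
Qed.

(** Replaces a passage to the limit [a -> 0]. If [D < c], the choice [a = 1/2] forces [c > 0], and
    then [a = (c - D) / (2 c)] gives [(c + D) / 2 <= D], a contradiction. *)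
Lemma ler_of_shrink {R : realFieldType} (c D : R) :
  (forall a, 0 < a < 1 -> (1 - a) * c <= D) -> c <= D.
Proof.
move=> cD; rewrite leNgt; apply/negP => D_lt_c.
have D_ge : c <= 2 * D.
  have h : (0 < (2^-1 : R) < 1) by apply/andP; split; lra.
  by move: (cD _ h); lra.
have c_gt0 : 0 < c by lra.
have : 0 < (c - D) / (2 * c) < 1.
  by rewrite divr_gt0 ?mulr_gt0 ?subr_gt0//= ltr_pdivrMr ?mulr_gt0//; lra.
move=> /cD; have -> : (1 - (c - D) / (2 * c)) * c = (c + D) / 2.
  by field; rewrite gt_eqF.
by lra.
Qed.

Definition segment_closed {R : realType} {E : normedModType R} (S : set E) :=
  forall x y (a : R), S x -> S y -> 0 <= a <= 1 -> S (a *: x + (1 - a) *: y).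

Section Convexity.
Context {R : realType} {E : normedModType R}.
Implicit Types (S Q : set E) (x y z : E).

Lemma convex_set_segment Q :
  convex_set (Q : set (convex_lmodType E)) -> segment_closed Q.
Proof.
move=> Q_cvx x y a Qx Qy a01.
by have /set_mem := Q_cvx x y (Itv01 (proj1 (andP a01)) (proj2 (andP a01)))
  (mem_set Qx) (mem_set Qy).
Qed.

Lemma convex_combB x y z (a : R) :
  a *: x + (1 - a) *: y - z = a *: (x - z) + (1 - a) *: (y - z).
Proof. by rewrite !scalerBr addrACA -opprD -scalerDl subrKC scale1r. Qed.

Lemma local_set_segment Q z (r : R) :
  segment_closed Q -> segment_closed (local_set Q z r).
Proof.
move=> Q_cvx x y a [Qx /= xr] [Qy /= yr] /[dup] a01 /andP[a0 a1].
split=> /=; first exact: Q_cvx.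
rewrite convex_combB (le_trans (ler_normD _ _))// !normrZ.
rewrite ger0_norm// ger0_norm ?subr_ge0//.
rewrite (_ : r = a * r + (1 - a) * r); last by ring.
by rewrite lerD// ler_wpM2l// subr_ge0.
Qed.

(** Minimality of [y] is tested at [a x + (1 - a) y]. After division by [a], strong convexity leaves
    the quadratic term with the factor [1 - a], which [ler_of_shrink] removes. *)
Lemma strongly_convex_min S (h : E -> R) (sg : R) y :
  segment_closed S -> strongly_convex S h sg -> S y ->
  (forall x, S x -> h y <= h x) ->
  forall x, S x -> h y + 2^-1 * sg * `|x - y| ^+ 2 <= h x.
Proof.
move=> S_cvx h_scvx Sy y_min x Sx.
rewrite addrC -lerBrDr; apply: ler_of_shrink => a /andP[a0 a1].
have a01 : 0 <= a <= 1 by rewrite !ltW.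
have := le_trans (y_min _ (S_cvx _ _ _ Sx Sy a01)) (h_scvx _ _ _ Sx Sy a01).
set t := _ ^+ 2 => ineq; rewrite -(ler_pM2l a0); lra.
Qed.

(** The subgradient inequality at a point of the segment is combined with uniform convexity and
    divided by the weight [1 - c] of [y]. Of the bracket times [c] only
    [c * c ^ (rho - 1) = c ^ rho] is kept; it tends to 1, so the constant [muf / 2] survives in the
    limit. *)
Lemma uniformly_convex_subgradient Q f (rho muf : R) x y (g : {scalar E}) :
  2 <= rho -> 0 <= muf -> segment_closed Q -> uniformly_convex Q f rho muf ->
  is_subgradient Q f x g -> Q x -> Q y ->
  g (y - x) + 2^-1 * muf * `|y - x| `^ rho <= f y - f x.
Proof.
move=> rho2 muf0 Q_cvx f_ucvx fg Qx Qy; rewrite addrC -lerBrDr.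
apply: ler_of_shrink => b /andP[b0 b1].
(* the point [a y + (1 - a) x] with [(1 - a) ^ rho = 1 - b] *)
pose c := (1 - b) `^ rho^-1.
have rho0 : 0 < rho by lra.
have c0 : 0 < c by rewrite powR_gt0// subr_gt0.
have crho : c `^ rho = 1 - b.
  by rewrite /c -powRrM mulVf ?gt_eqF// powRr1// subr_ge0 ltW.
have c1 : c < 1.
  suff : c < 1 `^ rho^-1 by rewrite powR1.
  rewrite gt0_ltr_powR ?invr_gt0 ?nnegrE ?subr_ge0 ?ltW//.
  by rewrite gtrBl.
have a01 : 0 <= 1 - c <= 1 by lra.
have := f_ucvx y x (1 - c) Qy Qx a01.
have := fg _ (Q_cvx _ _ _ Qy Qx a01).
rewrite convex_combB subrr scaler0 addr0 linearZ /= subKr.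
have : (1 - b) <= c * ((1 - c) `^ (rho - 1) + c `^ (rho - 1)).
  by rewrite mulrDr mulr_powRB1 ?(ltW c0)// crho lerDr mulr_ge0 ?powR_ge0 ?ltW.
set w := c * _ => bw; set t := `|_| `^ _; set gy := g (y - x) => h1 h2.
have ac : 0 < 1 - c by lra.
have muft : 0 <= 2^-1 * muf * t by rewrite !mulr_ge0// powR_ge0.
have : (1 - b) * (2^-1 * muf * t) <= w * (2^-1 * muf * t) by rewrite ler_wpM2r.
move=> /le_trans; apply; rewrite -(ler_pM2l ac) /w.
move: h1 h2; set u := (_ `^ (rho - 1) + _); nra.
Qed.

(** Jensen's inequality for equal weights, by induction: the new point gets weight [1 / (N + 2)] and
    the previous average the rest. Membership of the average is proved alongside, since convexity of
    [F] is assumed on [S] only. *)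
Lemma convex_average S (F : E -> R) (N : nat) (u : nat -> E) :
  segment_closed S ->
  (forall x y a, S x -> S y -> 0 <= a <= 1 ->
    F (a *: x + (1 - a) *: y) <= a * F x + (1 - a) * F y) ->
  (forall i, S (u i)) ->
  let avg := N.+1%:R^-1 *: \sum_(i < N.+1) u i in
  S avg /\ F avg <= N.+1%:R^-1 * \sum_(i < N.+1) F (u i).
Proof.
move=> S_cvx F_cvx Su; elim: N => [|N [IHS IHF]] /=.
  by rewrite !big_ord_recr !big_ord0/= !add0r invr1 scale1r mul1r.
pose a : R := N.+2%:R^-1.
have N2 : 0 < N.+2%:R :> R by rewrite ltr0n.
have N1 : 0 < N.+1%:R :> R by rewrite ltr0n.
have a01 : 0 <= a <= 1 by rewrite invr_ge0 ltW//= invf_le1// ler1n.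
have aE : 1 - a = N.+2%:R^-1 * N.+1%:R.
  have -> : N.+1%:R = N.+2%:R - 1 :> R by rewrite -[N.+2%:R]natr1 addrK.
  by rewrite mulrBr mulr1 mulVf// gt_eqF.
have -> : N.+2%:R^-1 *: \sum_(i < N.+2) u i =
    a *: u N.+1 + (1 - a) *: (N.+1%:R^-1 *: \sum_(i < N.+1) u i).
  by rewrite big_ord_recr/= scalerDr addrC scalerA aE mulfK// gt_eqF.
split; first exact: S_cvx.
rewrite (le_trans (F_cvx _ _ _ _ _ a01))// [in leRHS]big_ord_recr/= mulrDr addrC lerD//.
rewrite aE -mulrA ler_wpM2l ?invr_ge0 ?(ltW N2)//.
by rewrite mulrC -ler_pdivlMr// mulrC.
Qed.

Lemma norm_powR_convex (rho : R) z x y (a : R) : 1 <= rho -> 0 <= a <= 1 ->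
  `|a *: x + (1 - a) *: y - z| `^ rho <=
  a * `|x - z| `^ rho + (1 - a) * `|y - z| `^ rho.
Proof.
move=> rho1 /[dup] a01 /andP[a0 a1].
have norm_ge0 v : `|v : E| \in `[0, +oo[%classic.
  by rewrite inE /= in_itv/= normr_ge0.
have : (a * `|x - z| + (1 - a) * `|y - z|) `^ rho <=
    a * `|x - z| `^ rho + (1 - a) * `|y - z| `^ rho :=
  @convex_powR R _ rho1 (Itv01 a0 a1) _ _ (norm_ge0 (x - z)) (norm_ge0 (y - z)).
apply: le_trans; rewrite ge0_ler_powR ?nnegrE//.
- exact: le_trans rho1.
- by rewrite addr_ge0// mulr_ge0// subr_ge0.
rewrite convex_combB (le_trans (ler_normD _ _))// !normrZ.
by rewrite ger0_norm// ger0_norm ?subr_ge0.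
Qed.

End Convexity.

(** * Dual averaging *)

Section DualAveraging.
Context {R : realType} {E : normedModType R} {n : nat}.
Hypothesis E_dim : Vector.axiom n E.
Context {Q : set E} {d : E -> R} {f' : E -> {scalar E}} {mud L : R}.
Hypothesis Q_closed : closed Q.
Hypothesis Q_cvx : segment_closed Q.
Hypothesis f'_bounded : forall x, Q x -> dual_norm (f' x) <= L.
Hypothesis d_cont : {within (unit_ball : set E), continuous d}.
Hypothesis d0 : d 0 = 0.
Hypothesis d_ge0 : forall x : E, unit_ball x -> 0 <= d x.
Hypothesis mud_gt0 : 0 < mud.
Hypothesis d_scvx : strongly_convex unit_ball d mud.
Implicit Types (x z : E) (r beta : R).

Lemma scalar_continuous (s : {scalar E}) : continuous s.
Proof.
have [C sC] := finite_dim_scalar_bounded E_dim s.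
exact: (@norm_bounded_linear_continuous _ _ R^o s C sC).
Qed.

Lemma dual_norm_has_ubound (s : {scalar E}) :
  has_ubound [set s x | x in unit_ball].
Proof.
have [C sC] := finite_dim_scalar_bounded E_dim s.
exists `|C| => _ [y y1 <-].
rewrite (le_trans (ler_norm _))// (le_trans (sC _))//.
rewrite (le_trans (ler_wpM2r _ (ler_norm C)))// -[leRHS]mulr1.
by rewrite ler_wpM2l.
Qed.

Lemma dual_norm_ge0 (s : {scalar E}) : 0 <= dual_norm s.
Proof.
apply: ub_le_sup; first exact: dual_norm_has_ubound.
by exists 0; [rewrite /unit_ball /= normr0|rewrite linear0].
Qed.

Lemma ler_dual_norm (s : {scalar E}) x : s x <= dual_norm s * `|x|.
Proof.
have [->|x_neq0] := eqVneq x 0; first by rewrite linear0 normr0 mulr0.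
rewrite -ler_pdivrMr ?normr_gt0// mulrC.
apply: ub_le_sup; first exact: dual_norm_has_ubound.
exists (`|x|^-1 *: x); last by rewrite linearZ.
by rewrite /unit_ball /= normrZ normfV normr_id mulVf// normr_eq0.
Qed.

Lemma compact_unit_ball : compact (unit_ball : set E).
Proof.
apply: (@finite_dim_compact _ _ _ E_dim _ 1) => //.
apply: (@closed_comp _ _ (fun x : E => `|x|) [set t | t <= 1]).
  by move=> x _; exact: norm_continuous.
exact: closed_le.
Qed.

(** A supremum is an upper bound only once the set is bounded above; this comes from continuity of
    [d] on the compact unit ball. *)
Lemma ler_prox_max x : unit_ball x -> d x <= prox_max d.
Proof.
move=> x1; have ball0 : (unit_ball : set E) 0 by rewrite /unit_ball /= normr0.
have ball_neq0 : (unit_ball : set E) !=set0 by exists 0.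
have [c _ d_max] := compact_EVT_max ball_neq0 compact_unit_ball d_cont.
apply: ub_le_sup; last by exists x.
by exists (d c) => _ [y y1 <-]; apply/d_max/mem_set.
Qed.

Lemma prox_max_ge0 : 0 <= prox_max d.
Proof. by rewrite -d0 ler_prox_max// /unit_ball /= normr0. Qed.

(** If the maximum is 0, then [d] vanishes on the ball, whereas strong convexity makes it negative
    strictly between 0 and a unit vector. Hence there is no unit vector. *)
Lemma prox_max_eq0 x : prox_max d = 0 -> x = 0.
Proof.
move=> A0; apply/eqP/negPn/negP => x_neq0.
have dB0 y : unit_ball y -> d y = 0.
  by move=> y1; apply/eqP; rewrite eq_le d_ge0// andbT -A0 ler_prox_max.
pose y := `|x|^-1 *: x.
have y1 : `|y| = 1 by rewrite normrZ normfV normr_id mulVf// normr_eq0.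
have By : unit_ball y by rewrite /unit_ball /= y1.
have B0 : unit_ball (0 : E) by rewrite /unit_ball /= normr0.
have [a [a0 a1]] : exists a : R, 0 < a /\ a < 1 by exists 2^-1; split; lra.
have a01 : 0 <= a <= 1 by rewrite !ltW.
have Bm : unit_ball (a *: y + (1 - a) *: 0).
  by rewrite scaler0 addr0 /unit_ball /= normrZ y1 mulr1 ger0_norm ltW.
have := d_scvx _ _ _ By B0 a01.
rewrite !dB0// subr0 y1 expr1n mulr1 !mulr0 !add0r oppr_ge0.
by rewrite leNgt !mulr_gt0// ?subr_gt0.
Qed.

Lemma subr_continuous z : continuous (fun x => x - z).
Proof. by move=> x; apply: cvgB; [exact: cvg_id|exact: cvg_cst]. Qed.

(** * The prox-subproblem and the regret estimate on one local set *)

Section LocalSet.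
Context (z : E) (r : R).
Hypothesis Qz : Q z.
Hypothesis r_gt0 : 0 < r.

Lemma local_set_center : local_set Q z r z.
Proof. by split => //=; rewrite subrr normr0 ltW. Qed.

Lemma unit_ball_rescale x : local_set Q z r x -> unit_ball (r^-1 *: (x - z)).
Proof.
move=> [_ /= xr]; rewrite /unit_ball /= normrZ gtr0_norm ?invr_gt0//.
by rewrite mulrC ler_pdivrMr// mul1r.
Qed.

Lemma compact_local_set : compact (local_set Q z r).
Proof.
apply: (@finite_dim_compact _ _ _ E_dim _ (r + `|z|)) => [x [_ /= xr]|].
  by rewrite -[x](subrK z) (le_trans (ler_normD _ _))// lerD2r.
apply: closedI => //.
apply: (@closed_comp _ _ (fun x : E => `|x - z|) [set t | t <= r]).
  move=> x _; apply: (@continuous_comp _ _ _ (fun x => x - z) (fun x => `|x|)).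
    exact: subr_continuous.
  exact: norm_continuous.
exact: closed_le.
Qed.

Lemma scaled_prox_strongly_convex :
  strongly_convex (local_set Q z r) (scaled_prox d z r) (mud / r ^+ 2).
Proof.
move=> x y a Sx Sy a01; rewrite /scaled_prox.
rewrite convex_combB scalerDr !scalerA !(mulrC r^-1) -!scalerA.
apply: le_trans (d_scvx _ _ _ (unit_ball_rescale _ Sx) (unit_ball_rescale _ Sy) a01) _.
rewrite -scalerBr opprB addrA subrK normrZ exprMn gtr0_norm ?invr_gt0//.
rewrite lerD2l lerN2 exprVn le_eqVlt; apply/orP; left; apply/eqP.
by field; rewrite gt_eqF.
Qed.

Lemma prox_map_max beta (s : E -> R) : continuous s ->
  let y := prox_map Q d z r beta s in
  local_set Q z r y /\ forall x, local_set Q z r x ->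
    s (x - z) - beta * scaled_prox d z r x <=
    s (y - z) - beta * scaled_prox d z r y.
Proof.
(* The remaining case is the default value of [argmax]; it is excluded by exhibiting a maximizer on
   the compact local set. *)
move=> s_cont /=; rewrite /prox_map /argmax; case: xgetP => [y _ []//|none].
have rescale_cont : continuous (fun x : E => r^-1 *: (x - z)).
  move=> x; apply: (@continuous_comp _ _ _ (fun x => x - z) ( *:%R r^-1)).
    exact: subr_continuous.
  exact: scaler_continuous.
have S_neq0 : local_set Q z r !=set0 by exists z; exact: local_set_center.
have g_cont : {within local_set Q z r, continuous
    (fun x => s (x - z) - beta * scaled_prox d z r x)}.
  have s_subr_cont : {within local_set Q z r, continuous (s \o (fun x => x - z))}.
    apply: continuous_subspaceT => t.
    apply: (@continuous_comp _ _ _ (fun x => x - z) s); last exact: s_cont.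
    exact: subr_continuous.
  have prox_cont := within_continuous_comp_sub _ _ _ _
    unit_ball_rescale rescale_cont d_cont.
  move=> x; apply: cvgB; first exact: s_subr_cont.
  by apply: cvgM; [exact: cvg_cst|exact: prox_cont].
have [c /set_mem Sc c_max] := compact_EVT_max S_neq0 compact_local_set g_cont.
by case: (none c); split=> // x Sx; apply: c_max; exact: mem_set.
Qed.

Context (beta : R).
Hypothesis beta_ge0 : 0 <= beta.

Local Notation xk k := (dual_averaging Q d f' z r beta k).1.
Local Notation sk k := (dual_averaging Q d f' z r beta k).2.

Lemma dual_averaging_fstS k : xk k.+1 = prox_map Q d z r beta (\- sk k.+1).
Proof. by rewrite /=; case: (dual_averaging Q d f' z r beta k). Qed.

Lemma dual_averaging_snd k x : sk k x = \sum_(i < k) f' (xk i) x.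
Proof.
elim: k => [|k IHk]; first by rewrite big_ord0.
rewrite big_ord_recr -IHk /=.
by case: (dual_averaging Q d f' z r beta k).
Qed.

Lemma dual_averaging_snd_continuous k : continuous (sk k).
Proof.
elim: k => [|k IHk] /=; first exact: cst_continuous.
move: IHk; case: (dual_averaging Q d f' z r beta k) => x s /= s_cont t.
by apply: cvgD; [exact: s_cont|exact: scalar_continuous].
Qed.

Lemma dual_averaging_max k :
  local_set Q z r (xk k) /\ forall x, local_set Q z r x ->
    - sk k (x - z) - beta * scaled_prox d z r x <=
    - sk k (xk k - z) - beta * scaled_prox d z r (xk k).
Proof.
case: k => [|k]; last first.
  rewrite dual_averaging_fstS; apply: (prox_map_max beta (\- sk k.+1)) => t.
  by apply: cvgN; exact: dual_averaging_snd_continuous.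
(* The starting point is the center and not a value of [prox_map]; it is still a maximizer, because
   [s_0 = 0] and [d] is minimal at 0. *)
split=> [|x Sx]; first exact: local_set_center.
rewrite /= !oppr0 !add0r lerN2 ler_wpM2l// /scaled_prox subrr scaler0 d0.
exact/d_ge0/unit_ball_rescale.
Qed.

Lemma dual_averaging_in k : Q (xk k).
Proof. by have [[]] := dual_averaging_max k. Qed.

Lemma dual_averaging_regret k x : 0 < beta -> local_set Q z r x ->
  \sum_(i < k) f' (xk i) (xk i - x) <=
  beta * scaled_prox d z r x + k%:R * (L ^+ 2 * r ^+ 2 / (2 * beta * mud)).
Proof.
move=> beta_gt0 Sx; pose C := L ^+ 2 * r ^+ 2 / (2 * beta * mud).
(* The invariant is stated for every point of the local set, so that the induction can apply it at
   the current maximizer [x_k]. *)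
suff inv : forall y, local_set Q z r y ->
    - sk k (y - z) - beta * scaled_prox d z r y <=
    - \sum_(i < k) f' (xk i) (xk i - z) + k%:R * C.
  have := inv x Sx; rewrite dual_averaging_snd.
  have -> : \sum_(i < k) f' (xk i) (xk i - x) =
      \sum_(i < k) f' (xk i) (xk i - z) - \sum_(i < k) f' (xk i) (x - z).
    rewrite -sumrB; apply: eq_bigr => i _.
    by rewrite -linearB opprB addrA subrK.
  rewrite -/C; lra.
elim: k {x Sx} => [|k IHk] x Sx.
  rewrite big_ord0 mul0r addr0 /= !oppr0 add0r oppr_le0 mulr_ge0//.
  exact/d_ge0/unit_ball_rescale.
have [Sk k_max] := dual_averaging_max k.
(* The negated objective is a linear function plus [beta] times the rescaled prox-function, so it
   has modulus [beta mud / r ^ 2]. *)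
have scvx : strongly_convex (local_set Q z r)
    (fun y => sk k (y - z) + beta * scaled_prox d z r y) (beta * (mud / r ^+ 2)).
  move=> u v a Su Sv a01; rewrite !dual_averaging_snd.
  have -> : \sum_(i < k) f' (xk i) (a *: u + (1 - a) *: v - z) =
     a * (\sum_(i < k) f' (xk i) (u - z)) + (1 - a) * (\sum_(i < k) f' (xk i) (v - z)).
    rewrite !mulr_sumr -big_split; apply: eq_bigr => i _ /=.
    by rewrite convex_combB linearD !linearZ.
  have := scaled_prox_strongly_convex _ _ _ Su Sv a01.
  rewrite -(ler_pM2l beta_gt0); lra.
have y_min y : local_set Q z r y ->
    sk k (xk k - z) + beta * scaled_prox d z r (xk k) <=
    sk k (y - z) + beta * scaled_prox d z r y.
  by move=> /k_max; lra.
have := strongly_convex_min _ _ _ _ (local_set_segment _ _ _ Q_cvx) scvx Sk y_min _ Sx.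
have := IHk _ Sk; rewrite big_ord_recr /= -/(xk k).
have -> : (let: (x0, s) := dual_averaging Q d f' z r beta k in
   (prox_map Q d z r beta (\- (s \+ f' x0)), s \+ f' x0)).2 (x - z) =
   sk k (x - z) + f' (xk k) (x - z).
  by case: (dual_averaging Q d f' z r beta k).
have := ler_dual_norm (f' (xk k)) (xk k - x).
have : dual_norm (f' (xk k)) * `|xk k - x| <= L * `|xk k - x|.
  by rewrite ler_wpM2r// f'_bounded//; exact: dual_averaging_in.
rewrite distrC; set t := `|_|; move=> gL1 gL2.
have -> : f' (xk k) (x - z) = f' (xk k) (xk k - z) - f' (xk k) (xk k - x).
  by rewrite -linearB opprB [in RHS](addrC (xk k - z)) addrA subrK.
(* The linear error of the new subgradient is absorbed by the quadratic growth at [x_k], at the cost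
   of [C]; the difference is the square [(sg t - L) ^ 2 / (2 sg)]. *)
have : L * t <= 2^-1 * (beta * (mud / r ^+ 2)) * t ^+ 2 + C.
  have sg_gt0 : 0 < beta * (mud / r ^+ 2) by rewrite mulr_gt0// divr_gt0// exprn_gt0.
  have -> : C = L ^+ 2 / (2 * (beta * (mud / r ^+ 2))).
    by rewrite /C; field; rewrite !gt_eqF.
  rewrite -subr_ge0; move: sg_gt0; set sg := beta * _ => sg_gt0.
  have -> : 2^-1 * sg * t ^+ 2 + L ^+ 2 / (2 * sg) - L * t =
     (sg * t - L) ^+ 2 / (2 * sg) by field; rewrite gt_eqF.
  by rewrite divr_ge0 ?sqr_ge0// mulr_ge0// ltW.
have -> : k.+1%:R = k%:R + 1 :> R by rewrite natr1.
rewrite mulrDl mul1r; lra.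
Qed.

End LocalSet.

(** * Gap value and output of one run of dual averaging *)

Section Gap.
Context {z : E} {r : R} {N : nat}.
Hypothesis Qz : Q z.
Hypothesis r_gt0 : 0 < r.

Local Notation A := (prox_max d).
Local Notation gamma := (stage_gamma L mud A r).
Local Notation x_ i := (da_iterate Q d f' gamma N z r i).
Local Notation gap := (da_gap Q d f' gamma N z r).
Local Notation avg_regret x :=
  (N.+1%:R^-1 * \sum_(i < N.+1) f' (x_ i) (x_ i - x)).

Lemma lipschitz_ge0 : 0 <= L.
Proof. exact: le_trans (dual_norm_ge0 (f' z)) (f'_bounded _ Qz). Qed.

Lemma da_beta_ge0 : 0 <= gamma * Num.sqrt N.+1%:R.
Proof.
by rewrite mulr_ge0 ?sqrtr_ge0// divr_ge0 ?sqrtr_ge0// mulr_ge0 ?lipschitz_ge0 ?ltW.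
Qed.

Lemma da_iterate_in i : Q (x_ i).
Proof. exact: dual_averaging_in Qz r_gt0 _ da_beta_ge0 i. Qed.

Lemma da_regret x : local_set Q z r x ->
  avg_regret x <= L * r * Num.sqrt (2 * mud * A) / (mud * Num.sqrt N.+1%:R).
Proof.
move=> Sx; have L0 := lipschitz_ge0; have A0 := prox_max_ge0.
have N1_ge0 : 0 <= N.+1%:R^-1 :> R by rewrite invr_ge0.
have [L_eq0|L_neq0] := eqVneq L 0.
  have -> : L * r * Num.sqrt (2 * mud * A) / (mud * Num.sqrt N.+1%:R) = 0.
    by rewrite L_eq0 !mul0r.
  rewrite mulr_ge0_le0// sumr_le0// => i _.
  rewrite (le_trans (ler_dual_norm _ _))// mulr_le0_ge0//.
  by rewrite -L_eq0 f'_bounded//; exact: da_iterate_in.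
have [A_eq0|A_neq0] := eqVneq A 0.
  rewrite big1 => [|i _].
    by rewrite mulr0 divr_ge0 ?mulr_ge0 ?sqrtr_ge0// ltW.
  by rewrite (prox_max_eq0 (x_ i - x) A_eq0) linear0.
have L_gt0 : 0 < L by rewrite lt_def L_neq0.
have A_gt0 : 0 < A by rewrite lt_def A_neq0.
pose sg := Num.sqrt (2 * mud * A); pose q := Num.sqrt N.+1%:R : R.
have sg_gt0 : 0 < sg by rewrite sqrtr_gt0 !mulr_gt0.
have q_gt0 : 0 < q by rewrite sqrtr_gt0.
have sg2 : sg ^+ 2 = 2 * mud * A by rewrite sqr_sqrtr// ltW// !mulr_gt0.
have q2 : q ^+ 2 = N.+1%:R by rewrite sqr_sqrtr.
pose beta := gamma * q.
have beta_gt0 : 0 < beta by rewrite mulr_gt0// divr_gt0// mulr_gt0.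
have := dual_averaging_regret _ _ Qz r_gt0 _ da_beta_ge0 N.+1 _ beta_gt0 Sx.
move=> /(ler_wpM2l N1_ge0) /le_trans; apply; rewrite -/q -/beta.
have : beta * scaled_prox d z r x <= beta * A.
  by rewrite ler_wpM2l ?(ltW beta_gt0)// ler_prox_max//; exact: unit_ball_rescale.
rewrite -q2 => betaA; rewrite -/sg -/q.
(* This [gamma] balances the two contributions: [beta A / q ^ 2] and [L ^ 2 r ^ 2 / (2 beta mud)]
   both equal [L r sg / (2 mud q)]. *)
have -> : L * r * sg / (mud * q) =
    (q ^+ 2)^-1 * (beta * A + q ^+ 2 * (L ^+ 2 * r ^+ 2 / (2 * beta * mud))).
  have -> : A = sg ^+ 2 / (2 * mud) by rewrite sg2; field; rewrite gt_eqF.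
  by rewrite /beta /stage_gamma -/sg; field; rewrite !gt_eqF.
by rewrite ler_wpM2l ?invr_ge0 ?sqr_ge0// lerD2r.
Qed.

Lemma da_gap_le :
  gap <= L * r * Num.sqrt (2 * mud * A) / (mud * Num.sqrt N.+1%:R).
Proof.
apply: ge_sup => [|_ [x Sx <-]]; last exact: da_regret.
by exists (avg_regret z); exists z => //; exact: local_set_center.
Qed.

Lemma da_gap_ge x : local_set Q z r x -> avg_regret x <= gap.
Proof.
move=> Sx; apply: ub_le_sup; last by exists x.
exists (L * r * Num.sqrt (2 * mud * A) / (mud * Num.sqrt N.+1%:R)).
by move=> _ [y Sy <-]; exact: da_regret.
Qed.

Context {f : E -> R} {rho muf : R} {xs : E}.
Hypothesis rho_ge2 : 2 <= rho.
Hypothesis muf_gt0 : 0 < muf.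
Hypothesis f_ucvx : uniformly_convex Q f rho muf.
Hypothesis f'_subgradient : forall x, Q x -> is_subgradient Q f x (f' x).
Hypothesis xs_min : forall x, Q x -> f xs <= f x.
Hypothesis xs_local : local_set Q z r xs.

Local Notation y := (da_output Q d f' gamma N z r).

(** Only the membership half of [convex_average] matters, so [F] is taken constant. *)
Lemma da_output_in : Q y.
Proof.
by have [] := convex_average _ (fun=> 0) N (fun i => x_ i) Q_cvx
  (fun=> ltac:(move=> *; lra)) da_iterate_in.
Qed.

(** Jensen's inequality for [f - f xs] reduces the claim to the iterates, where the subgradient
    inequality at [x_i] is evaluated at [xs]; the average obtained is a competitor in the gap. *)
Lemma da_output_value : f y - f xs <= gap.
Proof.
apply: le_trans (da_gap_ge _ xs_local).
have f_cvx u v a : Q u -> Q v -> 0 <= a <= 1 ->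
    f (a *: u + (1 - a) *: v) - f xs <= a * (f u - f xs) + (1 - a) * (f v - f xs).
  move=> Qu Qv a01; have := f_ucvx _ _ _ Qu Qv a01; case/andP: a01 => a0 a1.
  have : 0 <= 2^-1 * muf * a * (1 - a) *
      (a `^ (rho - 1) + (1 - a) `^ (rho - 1)) * `|u - v| `^ rho.
    by rewrite !mulr_ge0 ?(ltW muf_gt0) ?subr_ge0 ?addr_ge0 ?powR_ge0.
  lra.
have [_ /le_trans->//] := convex_average _ _ N _ Q_cvx f_cvx da_iterate_in.
rewrite ler_wpM2l// ler_sum// => i _.
have := f'_subgradient _ (da_iterate_in i) xs (proj1 xs_local).
by rewrite -(opprB _ xs) linearN; lra.
Qed.

Lemma da_output_distance : muf * `|y - xs| `^ rho <= gap.
Proof.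
apply: le_trans (da_gap_ge _ xs_local).
have norm_cvx u v a : True -> True -> 0 <= a <= 1 ->
    muf * `|a *: u + (1 - a) *: v - xs| `^ rho <=
    a * (muf * `|u - xs| `^ rho) + (1 - a) * (muf * `|v - xs| `^ rho).
  move=> _ _ a01; have rho1 : 1 <= rho by rewrite (le_trans _ rho_ge2)// ler1n.
  have := norm_powR_convex rho xs u v _ rho1 a01.
  by rewrite -(ler_pM2l muf_gt0); lra.
have [_ /le_trans->//] := convex_average setT _ N _ (fun _ _ _ _ _ _ => I) norm_cvx
  (fun i => I : setT (x_ i)).
rewrite ler_wpM2l// ler_sum// => i _.
have Qi := da_iterate_in i; have Qs : Q xs := proj1 xs_local.
(* The zero functional at the minimizer yields half of the term, [f(x_i) - f(xs) >= muf / 2 * |x_i -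
   xs| ^ rho]; [f'(x_i)] yields the other half. *)
have xs_subgradient : is_subgradient Q f xs (\0 : {scalar E}).
  by move=> u Qu /=; rewrite addr0 xs_min.
have := uniformly_convex_subgradient _ _ _ _ _ _ _ rho_ge2 (ltW muf_gt0) Q_cvx
  f_ucvx (f'_subgradient _ Qi) Qi Qs.
have := uniformly_convex_subgradient _ _ _ _ _ _ _ rho_ge2 (ltW muf_gt0) Q_cvx
  f_ucvx xs_subgradient Qs Qi.
by rewrite (distrC xs) -(opprB _ xs) linearN /=; lra.
Qed.

End Gap.
End DualAveraging.

(** * Stage lengths and radii *)

Section StrictFloor.
Context {R : realType}.
Implicit Types a : R.

Lemma strict_floor_lt a : (strict_floor a)%:~R < a.
Proof. by rewrite -strict_floorP. Qed.

Lemma le_strict_floorD1 a : a <= (strict_floor a + 1)%:~R.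
Proof. by rewrite /strict_floor subrK ceil_ge. Qed.

Lemma natr_max0 (i : int) : `|(Num.max 0 i)%R|%N%:R = Num.max 0 i%:~R :> R.
Proof.
rewrite natr_absz ger0_norm ?le_max ?lexx//.
by case: (leP 0 i) => i0; [rewrite max_r ?ler0z|rewrite max_l ?lerz0 ?ltW].
Qed.

Lemma max0_strict_floor_le a : 0 <= a ->
  `|(Num.max 0 (strict_floor a))%R|%N%:R <= a.
Proof.
by move=> a0; rewrite natr_max0 ge_max a0 ltW// strict_floor_lt.
Qed.

(** The lower bound on the stage length: a run of [N] iterations averages [N + 1] points, and it is
    [N + 1] that enters the gap bound. *)
Lemma le_max0_strict_floorS a : a <= `|(Num.max 0 (strict_floor a))%R|%N.+1%:R.
Proof.
rewrite -natr1 natr_max0 (le_trans (le_strict_floorD1 a))// intrD.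
by rewrite lerD2r le_max lexx orbT.
Qed.

End StrictFloor.

(** The induction step is [2 q ^ (m + 1) <= q ^ (m + 2)], which is where [q >= 2] enters. *)
Lemma sum_expr_le {R : realType} (q : R) (m : nat) : 2 <= q ->
  \sum_(1 <= k < m.+1) q ^+ k <= q ^+ m.+1.
Proof.
move=> q2; have q0 : 0 <= q by exact: le_trans q2.
elim: m => [|m IHm]; first by rewrite big_geq// exprn_ge0.
rewrite big_nat_recr//= (le_trans (lerD IHm (lexx _)))// -mulr2n -mulr_natl.
by rewrite [leRHS]exprS ler_wpM2r// exprn_ge0.
Qed.

(** * Gap and cost estimates for the chosen stage parameters *)

Section StageArithmetic.
Context {R : realType} {rho muf mud L A R0 eps : R}.
Hypothesis rho_ge2 : 2 <= rho.
Hypothesis muf_gt0 : 0 < muf.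
Hypothesis mud_gt0 : 0 < mud.
Hypothesis A_ge0 : 0 <= A.
Hypothesis R0_gt0 : 0 < R0.
Hypothesis eps_gt0 : 0 < eps.

Local Notation tau := (2 * (rho - 1) / rho).
Local Notation m := (num_stages muf eps R0 rho).
Local Notation N := (stage_iterations L muf mud A R0 rho).

Let rho_gt0 : 0 < rho. Proof. by rewrite (lt_le_trans _ rho_ge2). Qed.

Lemma tau_ge1 : 1 <= tau.
Proof. by rewrite ler_pdivlMr// mul1r; move: rho_ge2; lra. Qed.

Lemma stage_radius_gt0 k : 0 < stage_radius R0 rho k.
Proof. by rewrite powR_gt0// mulr_gt0 ?powR_gt0// invr_gt0 exprn_gt0. Qed.

Lemma stage_radius_powR k : stage_radius R0 rho k `^ rho = 2 ^- k * R0 `^ rho.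
Proof.
by rewrite -powRrM mulVf ?gt_eqF// powRr1// mulr_ge0 ?powR_ge0 ?invr_ge0 ?exprn_ge0.
Qed.

Lemma stage_radius_exp2 k : stage_radius R0 rho k = 2 `^ (- (k%:R / rho)) * R0.
Proof.
rewrite /stage_radius powRM ?invr_ge0 ?exprn_ge0 ?powR_ge0//.
rewrite -powR_invn// -!powRrM mulfV ?gt_eqF// powRr1 ?(ltW R0_gt0)//.
by rewrite mulNr.
Qed.

(** Expresses the exponent [2 (rho - 1)] through [a ^ rho] and an integer power, so that [field] can
    treat [R0 ^ rho] as an atom. *)
Lemma powR_2rho1 (a : R) : 0 < a -> a `^ (2 * (rho - 1)) = (a `^ rho) ^+ 2 / a ^+ 2.
Proof.
move=> a0; rewrite -!powR_mulrn ?powR_ge0 ?ltW// -powRrM -powRB ?(gt_eqF a0) ?implybT//.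
by congr (a `^ _); ring.
Qed.

Lemma powR_rho_tau (a : R) : a `^ rho `^ tau = a `^ (2 * (rho - 1)).
Proof. by rewrite -powRrM mulrC divfK// gt_eqF. Qed.

(** Both sides are squared. Inserting the lower bound on [N + 1] then leaves an inequality between
    powers of 2. *)
Lemma stage_gap_bound k : 0 <= L ->
  L * stage_radius R0 rho k * Num.sqrt (2 * mud * A) /
    (mud * Num.sqrt (N k.+1).+1%:R) <= muf * (2 ^- k.+1 * R0 `^ rho).
Proof.
move=> L0; set r := stage_radius _ _ _; set P := R0 `^ rho.
have P_gt0 : 0 < P by rewrite powR_gt0.
have r_gt0 : 0 < r := stage_radius_gt0 k.
have target_gt0 : 0 < 2 ^- k.+1 * P by rewrite mulr_gt0// invr_gt0 exprn_gt0.
have N1_gt0 : 0 < (N k.+1).+1%:R :> R by rewrite ltr0n.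
rewrite -(@ler_pXn2r _ 2) ?nnegrE//; last 2 first.
- by rewrite divr_ge0// !mulr_ge0 ?sqrtr_ge0 ?(ltW r_gt0) ?(ltW mud_gt0).
- by rewrite mulr_ge0 ?(ltW muf_gt0) ?(ltW target_gt0).
rewrite !exprMn exprVn exprMn !sqr_sqrtr ?mulr_ge0 ?(ltW mud_gt0)//.
have := le_max0_strict_floorS (2 `^ (tau * k.+1%:R) *
  (4 * L ^+ 2 * A / (muf ^+ 2 * mud * R0 `^ (2 * (rho - 1))))).
rewrite -/(N k.+1) powR_2rho1// -/P => N_ge.
pose u : R := 2 `^ (tau * k.+1%:R); rewrite -/u in N_ge.
have u_gt0 : 0 < u by rewrite powR_gt0.
(* With [tau = 2 - 2 / rho], the exponents of 2 compare as [- 2 k / rho <= 1 - 2 (k + 1) / rho],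
   that is [2 / rho <= 1]. *)
have r2 : r ^+ 2 <= 2 * u * (2 ^- k.+1) ^+ 2 * R0 ^+ 2.
  rewrite /r stage_radius_exp2 exprMn ler_wpM2r ?exprn_ge0 ?(ltW R0_gt0)//.
  rewrite -!powR_invn// -!powR_mulrn ?powR_ge0// -!powRrM.
  rewrite -[X in X * u]powRr1// -!powRD ?pnatr_eq0 ?implybT//.
  rewrite ler_powR ?ler1n// -natr1.
  have -> : tau = 2 - 2 * rho^-1 by field; rewrite gt_eqF.
  have : 2 * rho^-1 <= 1 by rewrite ler_pdivrMr// mul1r.
  set x := rho^-1; set K := k%:R; lra.
rewrite ler_pdivrMr; last by rewrite mulr_gt0 ?exprn_gt0.
set v := 2 ^- k.+1 in r2 *; set N1 := _.+1%:R in N1_gt0 N_ge *.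
have {}N_ge : 4 * u * L ^+ 2 * A * R0 ^+ 2 <= N1 * (muf ^+ 2 * mud * P ^+ 2).
  move: N_ge; have -> : u * (4 * L ^+ 2 * A / (muf ^+ 2 * mud * (P ^+ 2 / R0 ^+ 2))) =
    4 * u * L ^+ 2 * A * R0 ^+ 2 / (muf ^+ 2 * mud * P ^+ 2).
    by field; rewrite !gt_eqF.
  by rewrite ler_pdivrMr// !mulr_gt0// exprn_gt0.
have LA_ge0 : 0 <= L ^+ 2 * (2 * mud * A) by rewrite !mulr_ge0 ?exprn_ge0 ?(ltW mud_gt0).
have := ler_wpM2l LA_ge0 r2.
have mv_ge0 : 0 <= mud * v ^+ 2 by rewrite mulr_ge0 ?sqr_ge0// ltW.
have := ler_wpM2l mv_ge0 N_ge.
lra.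
Qed.

Let C : R := 4 * L ^+ 2 * A / (muf ^+ 2 * mud).

Let C_ge0 : 0 <= C.
Proof.
apply: divr_ge0; last by apply: mulr_ge0; [exact: sqr_ge0|exact: ltW].
by apply: mulr_ge0 => //; apply: mulr_ge0; [|exact: sqr_ge0].
Qed.

Lemma stage_iterations_le k :
  (N k)%:R <= 2 `^ (tau * k%:R) * (C / R0 `^ (2 * (rho - 1))).
Proof.
have <- : 4 * L ^+ 2 * A / (muf ^+ 2 * mud * R0 `^ (2 * (rho - 1))) =
    C / R0 `^ (2 * (rho - 1)) by rewrite /C invfM mulrA.
apply: max0_strict_floor_le; rewrite mulr_ge0 ?powR_ge0//.
by rewrite invfM mulrA -/C divr_ge0 ?powR_ge0.
Qed.

(** Stage [k] costs at most [q ^ k C'] with [q = 2 ^ tau >= 2], so the geometric sum is at most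
    [q ^ (m + 1) C']. For negative [m] the sum is empty. *)
Lemma total_iterations_le :
  (\sum_(1 <= k < `|(Num.max 0 m)%R|%N.+1) N k)%N%:R <=
  (2 ^ (m + 1) / R0 `^ rho) `^ tau * C.
Proof.
have [m_ge0|m_lt0] := leP 0 m; last first.
  by rewrite big_geq// mulr_ge0 ?powR_ge0.
move: m_ge0; case: m => // M _; rewrite absz_nat.
pose q : R := 2 `^ tau.
have q_ge2 : 2 <= q by rewrite -[leLHS]powRr1// ler_powR ?tau_ge1// ler1n.
have P_gt0 : 0 < R0 `^ (2 * (rho - 1)) by rewrite powR_gt0.
pose C' := C / R0 `^ (2 * (rho - 1)).
have C'_ge0 : 0 <= C' by rewrite divr_ge0 ?powR_ge0.
have N_le k : (N k)%:R <= q ^+ k * C'.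
  apply: le_trans (stage_iterations_le k) _.
  by rewrite -powR_mulrn ?powR_ge0// -powRrM.
rewrite natr_sum (le_trans (ler_sum _ (fun k _ => N_le k)))// -mulr_suml.
rewrite (le_trans (ler_wpM2r C'_ge0 (sum_expr_le _ M q_ge2)))//.
rewrite -PoszD addn1 -exprnP powRM ?exprn_ge0 ?invr_ge0 ?powR_ge0//.
have -> : (2 ^+ M.+1 : R) `^ tau = q ^+ M.+1.
  by rewrite -!powR_mulrn ?powR_ge0// powRAC.
have -> : (R0 `^ rho)^-1 `^ tau = (R0 `^ (2 * (rho - 1)))^-1.
  by rewrite -powR_inv1 ?powR_ge0// powRAC powR_rho_tau powR_inv1 ?powR_ge0.
by rewrite /C' -mulrA [_^-1 * C]mulrC.
Qed.

Let log_ratio : R := ln (muf / eps * R0 `^ rho) / ln 2.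

Lemma powR2_log_ratio : 2 `^ log_ratio = muf / eps * R0 `^ rho.
Proof.
have ratio_gt0 : 0 < muf / eps * R0 `^ rho by rewrite mulr_gt0 ?powR_gt0 ?divr_gt0.
rewrite /powR pnatr_eq0 /= /log_ratio divfK ?lnK//.
by rewrite gt_eqF// ln_gt0// ltr1n.
Qed.

(** The accuracy side of the choice of [m]: the strict floor plus one is the ceiling, hence at least
    the logarithm. *)
Lemma ratio_le_exp2_stages : muf / eps * R0 `^ rho <= 2 ^ m.
Proof.
rewrite -powR2_log_ratio -powR_intmul// ler_powR ?ler1n//.
exact: le_strict_floorD1.
Qed.

(** The cost side of the choice of [m]: [m + 1] exceeds the logarithm by less than 2, whence the
    factor 4. *)
Lemma exp2_stages_lt : 2 ^ (m + 1) <= 4 * (muf / eps * R0 `^ rho).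
Proof.
rewrite -powR2_log_ratio -powR_intmul//.
have -> : 4 = 2 `^ 2 :> R by rewrite powR_mulrn// -natrX.
rewrite -powRD ?pnatr_eq0 ?implybT// ler_powR ?ler1n//.
have := strict_floor_lt log_ratio; rewrite /num_stages -/log_ratio !intrD; lra.
Qed.

Lemma total_iterations_bound :
  (2 ^ (m + 1) / R0 `^ rho) `^ tau * C <=
  4 `^ (tau + 1) * L ^+ 2 * A / (muf `^ (2 / rho) * mud) * eps `^ (- tau).
Proof.
have P_gt0 : 0 < R0 `^ rho by rewrite powR_gt0.
have tau_ge0 : 0 <= tau by rewrite (le_trans _ tau_ge1).
have ratio : 2 ^ (m + 1) / R0 `^ rho <= 4 * (muf / eps).
  by rewrite ler_pdivrMr// -mulrA exp2_stages_lt.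
have two_gt0 : 0 < 2 ^ (m + 1) :> R by rewrite exprz_gt0.
have ratio_ge0 : 0 <= 4 * (muf / eps) by rewrite mulr_ge0 ?divr_ge0 ?ltW.
have := ge0_ler_powR tau_ge0 (divr_ge0 (ltW two_gt0) (ltW P_gt0)) ratio_ge0 ratio.
move=> /(ler_wpM2r C_ge0) /le_trans; apply.
rewrite le_eqVlt; apply/orP; left; apply/eqP.
rewrite !powRM ?divr_ge0 ?invr_ge0 ?(ltW muf_gt0) ?(ltW eps_gt0)//.
rewrite -[eps^-1]powR_inv1 ?(ltW eps_gt0)// -powRrM mulN1r.
rewrite powRD ?pnatr_eq0 ?implybT// powRr1//.
(* As [tau = 2 - 2 / rho], the square cancels against [muf ^ 2] in the denominator of [C]. *)
have -> : muf `^ tau = muf ^+ 2 / muf `^ (2 / rho).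
  rewrite -powR_mulrn ?(ltW muf_gt0)// -powRB ?(gt_eqF muf_gt0) ?implybT//.
  by congr (_ `^ _); field; rewrite gt_eqF.
by rewrite /C; field; rewrite !gt_eqF ?powR_gt0.
Qed.

End StageArithmetic.

(** * Induction over the stages *)

Theorem theorem1 (R : realType) (E : normedModType R)
    (n : nat) (E_dim : Vector.axiom n E)
    (Q : set E) (f : E -> R) (f' : E -> {scalar E}) (d : E -> R)
    (rho muf mud L : R) (xs : E)
    (Q_closed : closed Q) (Q_convex : convex_set (Q : set (convex_lmodType E)))
    (rho_ge2 : 2 <= rho) (muf_gt0 : 0 < muf)
    (f_ucvx : uniformly_convex Q f rho muf)
    (f'_subgradient : forall x : E, Q x -> is_subgradient Q f x (f' x))
    (f'_bounded : forall x : E, Q x -> dual_norm (f' x) <= L)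
    (xs_in : Q xs) (xs_min : forall x : E, Q x -> f xs <= f x)
    (d_cont : {within (unit_ball : set E), continuous d})
    (d0 : d 0 = 0) (d_ge0 : forall x : E, unit_ball x -> 0 <= d x)
    (mud_gt0 : 0 < mud) (d_scvx : strongly_convex unit_ball d mud)
    (x0 : E) (x0_in : Q x0) (eps : R) (eps_gt0 : 0 < eps)
    (R0 : R) (R0_gt0 : 0 < R0) (x0_near : `|x0 - xs| <= R0) :
  let A := prox_max d in
  let tau := 2 * (rho - 1) / rho in
  let m := num_stages muf eps R0 rho in
  let N := stage_iterations L muf mud A R0 rho in
  let Rk := stage_radius R0 rho in
  let y := stage_point Q d f' rho muf mud L R0 x0 in
  let total := (\sum_(1 <= k < `|(Num.max 0 m)%R|.+1) N k)%N in
  [/\ (forall k : nat, k%:Z <= m ->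
         `|y k - xs| `^ rho <= Rk k `^ rho /\ Rk k `^ rho = 2 ^- k * R0 `^ rho),
      (forall k : nat, (1 <= k)%N -> k%:Z <= m ->
         stage_gap Q d f' rho muf mud L R0 x0 k <= muf * Rk k `^ rho /\
         muf * Rk k `^ rho = muf * 2 ^- k * R0 `^ rho),
      (0 < m -> f (y `|m|%N) - f xs <= eps),
      total%:R <= (2 ^ (m + 1) / R0 `^ rho) `^ tau
                  * (4 * L ^+ 2 * A / (muf ^+ 2 * mud))
    & (2 ^ (m + 1) / R0 `^ rho) `^ tau * (4 * L ^+ 2 * A / (muf ^+ 2 * mud))
        <= 4 `^ (tau + 1) * L ^+ 2 * A / (muf `^ (2 / rho) * mud)
           * eps `^ (- tau)].
Proof.
have Q_cvx := convex_set_segment _ Q_convex.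
have L_ge0 : 0 <= L := le_trans (dual_norm_ge0 E_dim (f' xs)) (f'_bounded _ xs_in).
have A_ge0 := prox_max_ge0 E_dim d_cont d0.
have rho_gt0 : 0 < rho by rewrite (lt_le_trans _ rho_ge2).
move=> A tau m N Rk y total.
have Rk_gt0 k : 0 < Rk k by exact: stage_radius_gt0.
have RkE k : Rk k `^ rho = 2 ^- k * R0 `^ rho by exact: stage_radius_powR.
(* Taking [rho]-th roots turns the distance estimate into membership of [xs] in the ball of the next
   stage. *)
have local_of k : `|y k - xs| `^ rho <= Rk k `^ rho ->
    local_set Q (y k) (Rk k) xs.
  move=> yk_near; split=> //=; rewrite distrC.
  have inv_ge0 : 0 <= rho^-1 by rewrite invr_ge0 ltW.
  have := ge0_ler_powR inv_ge0 (powR_ge0 _ _) (powR_ge0 _ _) yk_near.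
  rewrite -[_ `^ rho `^ _]powRrM -[Rk k `^ _ `^ _]powRrM mulfV ?gt_eqF//.
  by rewrite !powRr1 ?(ltW (Rk_gt0 k)).
(* One stage: the gap is at most [muf R_(k+1) ^ rho], and it dominates both [muf] times the [rho]-th
   power of the new distance and the new error in value. *)
have stage k : Q (y k) -> `|y k - xs| `^ rho <= Rk k `^ rho ->
    [/\ Q (y k.+1), `|y k.+1 - xs| `^ rho <= Rk k.+1 `^ rho,
        stage_gap Q d f' rho muf mud L R0 x0 k.+1 <= muf * Rk k.+1 `^ rho
      & f (y k.+1) - f xs <= stage_gap Q d f' rho muf mud L R0 x0 k.+1].
  move=> Qyk yk_near; have xs_local := local_of k yk_near.
  have -> : y k.+1 =
    da_output Q d f' (stage_gamma L mud A (Rk k)) (N k.+1) (y k) (Rk k) by [].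
  have -> : stage_gap Q d f' rho muf mud L R0 x0 k.+1 =
    da_gap Q d f' (stage_gamma L mud A (Rk k)) (N k.+1) (y k) (Rk k) by [].
  have gap_le : da_gap Q d f' (stage_gamma L mud A (Rk k)) (N k.+1) (y k) (Rk k)
      <= muf * Rk k.+1 `^ rho.
    apply: le_trans (da_gap_le E_dim Q_closed Q_cvx f'_bounded d_cont d0 d_ge0
      mud_gt0 d_scvx Qyk (Rk_gt0 k)) _.
    by rewrite RkE; apply: stage_gap_bound.
  split.
  - exact: (da_output_in E_dim Q_closed Q_cvx f'_bounded d_cont d0 d_ge0
      Qyk (Rk_gt0 k)).
  - rewrite -(ler_pM2l muf_gt0); apply: le_trans gap_le.
    exact: (da_output_distance E_dim Q_closed Q_cvx f'_bounded d_cont d0 d_ge0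
      mud_gt0 d_scvx Qyk (Rk_gt0 k) rho_ge2 muf_gt0 f_ucvx
      f'_subgradient xs_min xs_local).
  - exact: gap_le.
  - exact: (da_output_value E_dim Q_closed Q_cvx f'_bounded d_cont d0 d_ge0
      mud_gt0 d_scvx Qyk (Rk_gt0 k) muf_gt0 f_ucvx
      f'_subgradient xs_local).
have near k : Q (y k) /\ `|y k - xs| `^ rho <= Rk k `^ rho.
  elim: k => [|k [Qyk yk_near]]; last by have [] := stage k Qyk yk_near.
  split=> //; rewrite RkE expr0 invr1 mul1r.
  by rewrite ge0_ler_powR ?nnegrE// ltW.
split.
- by move=> k _; split; [exact: (near k).2|exact: RkE].
- move=> [//|k] _ _; split; last by rewrite RkE mulrA.
  by have [Qyk yk_near] := near k; have [] := stage k Qyk yk_near.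
(* The last stage has error at most [muf 2 ^ (- m) R0 ^ rho], and [2 ^ m] is at least
   [muf R0 ^ rho / eps]. *)
- move=> m_gt0; move: (@ratio_le_exp2_stages _ rho muf R0 eps muf_gt0 R0_gt0 eps_gt0).
  have [M mE] : exists M : nat, m = M.+1.
    by move: m_gt0; case: (m) => // -[//|M] _; exists M.
  rewrite -/m mE absz_nat => ratio_le.
  have [QyM yM_near] := near M; have [_ _ gap_le f_le] := stage M QyM yM_near.
  rewrite (le_trans f_le)// (le_trans gap_le)// RkE mulrCA.
  rewrite ler_pdivrMl ?exprn_gt0//.
  by move: ratio_le; rewrite mulrAC ler_pdivrMr.
- exact: total_iterations_le.
- exact: total_iterations_bound.
Qed.
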